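(* Let $(L,A,\phi,\alpha,\rho)$ be a regular Hom 3-Lie-Rinehart algebra which decomposes as a direct sum of finitely many ideals, $L=G_1\oplus\cdots\oplus G_s$, and suppose $Z_L(A)=0$. Then $(L,A,\phi,\alpha,\rho)$ is a split regular Hom 3-Lie-Rinehart algebra with a splitting Cartan subalgebra $H$ if and only if the $(G_j,A,\phi,\alpha|_{G_j},\rho|_{G_j\wedge G_j})$, $1\le j\le s$, are split regular Hom 3-Lie-Rinehart algebras with splitting Cartan subalgebras $H_j$, respectively, such that $H=\bigoplus_{j=1}^sH_j$ and $\Gamma=\bigcup_{j=1}^s\Gamma_j$, where $\Gamma$ is the root system of $L$ associated to $H$ and $\Gamma_j$ are the root systems of $G_j$ associated to $H_j$, respectively (an element $\gamma\in\Gamma_j\subset(H_j\wedge H_j)^*$ being regarded as an element of $(H\wedge H)^*$ by extension by zero).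
   Context: $F$ is a field of characteristic zero, all vector spaces and algebras are over $F$, and $A$ is a commutative associative $F$-algebra. A multiplicative Hom 3-Lie algebra $(L,[\,,\,,\,]_L,\alpha)$ is a vector space $L$ with a linear map $[\,,\,,\,]_L:\wedge^3L\to L$ and a linear map $\alpha:L\to L$ such that $\alpha([x,y,z]_L)=[\alpha(x),\alpha(y),\alpha(z)]_L$ and $[\alpha(x_1),\alpha(x_2),[x_3,x_4,x_5]_L]_L=[[x_1,x_2,x_3]_L,\alpha(x_4),\alpha(x_5)]_L+[\alpha(x_3),[x_1,x_2,x_4]_L,\alpha(x_5)]_L+[\alpha(x_3),\alpha(x_4),[x_1,x_2,x_5]_L]_L$ for all elements of $L$. A representation of it is a triple $(V,\phi,\rho)$ (also written $(V,\rho,\phi)$) with $V$ a vector space, $\rho:L\wedge L\to gl(V)$ and $\phi:V\to V$ linear, such that for all $x_i\in L$: $\rho(\alpha(x_1),\alpha(x_2))\phi=\phi\rho(x_1,x_2)$; $\rho([x_1,x_2,x_3]_L,\alpha(x_4))\phi=\rho(\alpha(x_1),\alpha(x_2))\rho(x_3,x_4)+\rho(\alpha(x_2),\alpha(x_3))\rho(x_1,x_4)+\rho(\alpha(x_3),\alpha(x_1))\rho(x_2,x_4)$; $\rho(\alpha(x_1),\alpha(x_2))\rho(x_3,x_4)=\rho(\alpha(x_3),\alpha(x_4))\rho(x_1,x_2)+\rho([x_1,x_2,x_3]_L,\alpha(x_4))\phi+\rho(\alpha(x_3),[x_1,x_2,x_4]_L)\phi$. For an algebra endomorphism $\phi$ of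 $A$, $Der_\phi(A)$ is the set of linear maps $D:A\to A$ with $D(ab)=\phi(a)D(b)+D(a)\phi(b)$. A Hom 3-Lie-Rinehart algebra $(L,A,[\,,\,,\,]_L,\phi,\alpha,\rho)$, also written $(L,A,\phi,\alpha,\rho)$, consists of a multiplicative Hom 3-Lie algebra $(L,[\,,\,,\,]_L,\alpha)$ with $L$ an $A$-module, an algebra homomorphism $\phi:A\to A$ and a linear map $\rho:L\wedge L\to Der_\phi(A)$ such that $(A,\rho,\phi)$ is a representation of $(L,[\,,\,,\,]_L,\alpha)$ and, for all $a\in A$, $x,y,z\in L$: $\alpha(ax)=\phi(a)\alpha(x)$, $[x,y,az]_L=\phi(a)[x,y,z]_L+\rho(x,y)(a)\alpha(z)$, $\rho(ax,y)=\rho(x,ay)=\phi(a)\rho(x,y)$. It is regular if $\alpha$ and $\phi$ are algebra automorphisms. An ideal of a Hom 3-Lie-Rinehart algebra is a subspace $I\subset L$ with $[I,L,L]_L\subset I$, $\alpha(I)\subset I$, $AI\subset I$ and $\rho(I,L)(A)L\subset I$; then $(I,A,\phi,\alpha|_I,\rho|_{I\wedge I})$ is a Hom 3-Lie-Rinehart algebra. $Z_L(A)=\{a\in A\mid ax=0\ \forall x\in L\}$. A regular Hom 3-Lie-Rinehart algebra is called split if there is a maximal abelian subalgebra $H$ of the Hom 3-Lie algebra $L$ (abelian: $[H,H,H]_L=0$) with $\alpha(H)=H$ and $L=H\oplus\bigoplus_{\gamma\in\Gamma}L_\gamma$, $A=A_0\oplus\bigoplus_{\lambda\in\Lambda}A_\lambda$,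 where for $\gamma,\lambda\in(H\wedge H)^*$, $L_\gamma=\{x\in L\mid [h_1,h_2,x]_L=\gamma(h_1,h_2)\alpha(x)\ \forall h_1,h_2\in H\}$, $L_0=H$, $A_\lambda=\{a\in A\mid \rho(h_1,h_2)(a)=\lambda(h_1,h_2)\phi(a)\ \forall h_1,h_2\in H\}$, $A_0=\{a\in A\mid\rho(H,H)(a)=0\}$, $\Gamma=\{\gamma\in(H\wedge H)^*\setminus\{0\}\mid L_\gamma\neq0\}$, $\Lambda=\{\lambda\in(H\wedge H)^*\setminus\{0\}\mid A_\lambda\neq0\}$. $H$ is called a splitting Cartan subalgebra, $\Gamma$ the root system of $L$, $\Lambda$ the weight system of $A$ (associated to $H$). Extension by zero: if $H=\bigoplus_jH_j$ with projections $p_j:H\to H_j$, then $\gamma\in(H_j\wedge H_j)^*$ is identified with the functional $(h_1,h_2)\mapsto\gamma(p_j(h_1),p_j(h_2))$ on $H\wedge H$. *)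

(* Defs.v *)
From HB Require Import structures.
From mathcomp Require Import all_boot all_order all_algebra.
From mathcomp Require Import boolp classical_sets functions cardinality fsbigop.

Set Implicit Arguments.
Unset Strict Implicit.
Unset Printing Implicit Defensive.

Import GRing.Theory.
Local Open Scope classical_set_scope.
Local Open Scope ring_scope.

Section Subspaces.
Variables (F : fieldType) (V : lmodType F).

Record subspace (S : submodClosed V) :=
  SubspaceElt { subspace_val : V; subspace_valP : subspace_val \in S }.

HB.instance Definition _ (S : submodClosed V) := [isSub for @subspace_val S].
HB.instance Definition _ (S : submodClosed V) := [Choice of subspace S by <:].
HB.instance Definition _ (S : submodClosed V) :=
  [SubChoice_isSubLmodule of subspace S by <:].

Definition decomposition (I : choiceType) (D : set I) (W : I -> set V) (x : V)
    (f : I -> V) : Prop :=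
  [/\ forall i, D i -> W i (f i),
      forall i, ~ D i -> f i = 0,
      finite_set [set i | f i != 0]
    & x = \sum_(i \in D) f i].

Definition direct_sum (I : choiceType) (D : set I) (W : I -> set V)
    (U : set V) : Prop :=
  (forall i, D i -> W i `<=` U) /\
  (forall x, U x -> exists! f, decomposition D W x f).

End Subspaces.

(* In characteristic zero, linear maps out of [V /\ V] and [V /\ V /\ V] are
   the multilinear maps that vanish when two arguments coincide. *)

Section Alternating.
Variables (F : fieldType) (U V : lmodType F).

Definition alternating2 (f : U -> U -> V) : Prop :=
  [/\ forall y, linear (f^~ y), forall x, linear (f x) & forall x, f x x = 0].

Definition alternating3 (f : U -> U -> U -> V) : Prop :=
  [/\ forall y z, linear (fun x => f x y z),
      forall x z, linear (fun y => f x y z),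
      forall x y, linear (fun z => f x y z)
    & forall x y, [/\ f x x y = 0, f x y x = 0 & f x y y = 0]].

End Alternating.

(* No unit is assumed, which is why [comAlgType F] is not used. *)

Record comAssocAlg (F : fieldType) := ComAssocAlg {
  alg_space :> lmodType F;
  alg_mul : alg_space -> alg_space -> alg_space;
  alg_mul_linear : forall a, linear (alg_mul a);
  alg_mulC : commutative alg_mul;
  alg_mulA : associative alg_mul }.

Section Modules.
Variables (F : fieldType) (A : comAssocAlg F).

Definition alg_hom (phi : A -> A) : Prop :=
  linear phi /\ {morph phi : a b / alg_mul a b}.

Definition twisted_der (phi : A -> A) (D : A -> A) : Prop :=
  linear D /\
  forall a b, D (alg_mul a b) = alg_mul (phi a) (D b) + alg_mul (D a) (phi b).

Definition is_module (M : lmodType F) (act : A -> M -> M) : Prop :=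
  [/\ forall a, linear (act a), forall x, linear (act^~ x)
    & forall a b x, act (alg_mul a b) x = act a (act b x)].

End Modules.

Section Hom3Lie.
Variables (F : fieldType) (L : lmodType F).
Variables (br : L -> L -> L -> L) (alpha : L -> L).

Record hom3Lie : Prop := Hom3Lie {
  br_alternating : alternating3 br;
  alpha_linear : linear alpha;
  alpha_br : forall x y z, alpha (br x y z) = br (alpha x) (alpha y) (alpha z);
  hom_jacobi : forall x1 x2 x3 x4 x5,
    br (alpha x1) (alpha x2) (br x3 x4 x5) =
      br (br x1 x2 x3) (alpha x4) (alpha x5)
      + br (alpha x3) (br x1 x2 x4) (alpha x5)
      + br (alpha x3) (alpha x4) (br x1 x2 x5) }.

Record hom3Lie_rep (V : lmodType F) (phi : V -> V) (rho : L -> L -> V -> V)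
    : Prop := Hom3LieRep {
  rep_phi_linear : linear phi;
  rep_rho_linear : forall x y, linear (rho x y);
  rep_rho_alternating : forall v, alternating2 (fun x y => rho x y v);
  rep_twist : forall x1 x2 v,
    rho (alpha x1) (alpha x2) (phi v) = phi (rho x1 x2 v);
  rep_br : forall x1 x2 x3 x4 v,
    rho (br x1 x2 x3) (alpha x4) (phi v) =
      rho (alpha x1) (alpha x2) (rho x3 x4 v)
      + rho (alpha x2) (alpha x3) (rho x1 x4 v)
      + rho (alpha x3) (alpha x1) (rho x2 x4 v);
  rep_comm : forall x1 x2 x3 x4 v,
    rho (alpha x1) (alpha x2) (rho x3 x4 v) =
      rho (alpha x3) (alpha x4) (rho x1 x2 v)
      + rho (br x1 x2 x3) (alpha x4) (phi v)
      + rho (alpha x3) (br x1 x2 x4) (phi v) }.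

End Hom3Lie.

Record hom3LR_axioms (F : fieldType) (A : comAssocAlg F) (L : lmodType F)
    (act : A -> L -> L) (br : L -> L -> L -> L) (phi : A -> A) (alpha : L -> L)
    (rho : L -> L -> A -> A) : Prop := Hom3LRAxioms {
  LR_hom3Lie : hom3Lie br alpha;
  LR_module : is_module act;
  LR_phi : alg_hom phi;
  LR_der : forall x y, twisted_der phi (rho x y);
  LR_rep : hom3Lie_rep br alpha phi rho;
  LR_alpha_act : forall a x, alpha (act a x) = act (phi a) (alpha x);
  LR_br_act : forall x y a z,
    br x y (act a z) = act (phi a) (br x y z) + act (rho x y a) (alpha z);
  LR_rho_actl : forall a x y b,
    rho (act a x) y b = alg_mul (phi a) (rho x y b);
  LR_rho_actr : forall a x y b,
    rho x (act a y) b = alg_mul (phi a) (rho x y b) }.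

Record hom3LR (F : fieldType) (A : comAssocAlg F) := Hom3LR {
  LR_space :> lmodType F;
  act : A -> LR_space -> LR_space;
  br : LR_space -> LR_space -> LR_space -> LR_space;
  phi : A -> A;
  alpha : LR_space -> LR_space;
  rho : LR_space -> LR_space -> A -> A;
  LR_axioms : hom3LR_axioms act br phi alpha rho }.

Arguments act {F A h}.
Arguments br {F A h}.
Arguments phi {F A} h.
Arguments alpha {F A h}.
Arguments rho {F A h}.

Section Theory.
Variables (F : fieldType) (A : comAssocAlg F).

(* [alpha] and [phi] are already multiplicative, so being an automorphism is
   being bijective. *)
Definition regular (L : hom3LR A) : Prop :=
  bijective (@alpha F A L) /\ bijective (phi L).

(* Z_L(A) *)
Definition annihilator (L : hom3LR A) : set A := [set a | forall x : L, act a x = 0].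

Record ideal (L : hom3LR A) := Ideal {
  ideal_space :> submodClosed L;
  ideal_br : forall x y z, x \in ideal_space -> br x y z \in ideal_space;
  ideal_alpha : forall x, x \in ideal_space -> alpha x \in ideal_space;
  ideal_act : forall a x, x \in ideal_space -> act a x \in ideal_space;
  ideal_rho : forall x y a z,
    x \in ideal_space -> act (rho x y a) z \in ideal_space }.

Section IdealAlgebra.
Variables (L : hom3LR A) (I : ideal L).
Implicit Types x y z : subspace I.

Definition ideal_act_op (a : A) x : subspace I :=
  SubspaceElt (ideal_act a (valP x)).
Definition ideal_br_op x y z : subspace I :=
  SubspaceElt (ideal_br (val y) (val z) (valP x)).
Definition ideal_alpha_op x : subspace I :=
  SubspaceElt (ideal_alpha (valP x)).
Definition ideal_rho_op x y : A -> A := rho (val x) (val y).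

Lemma ideal_hom3LR_axioms :
  hom3LR_axioms ideal_act_op ideal_br_op (phi L) ideal_alpha_op ideal_rho_op.
Proof.
have [[[bl1 bl2 bl3 b0] al ab hj] [m1 m2 m3] ph dr [rpl rl ra r1 r2 r3]
  aa ba ral rar] := LR_axioms L.
have vI : injective (val : subspace I -> L) by exact: val_inj.
split=> //.
- split.
  + split=> [y z a u v|x z a u v|x y a u v|x y].
    * by refine (vI _ _ _); apply: bl1.
    * by refine (vI _ _ _); apply: bl2.
    * by refine (vI _ _ _); apply: bl3.
    * by have [b1 b2 b3] := b0 (val x) (val y); split; refine (vI _ _ _).
  + by move=> a u v; refine (vI _ _ _); apply: al.
  + by move=> x y z; refine (vI _ _ _); apply: ab.
  + by move=> *; refine (vI _ _ _); apply: hj.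
- split=> [a b x y|x a b c|a b x]; refine (vI _ _ _).
  + exact: m1.
  + exact: m2.
  + exact: m3.
- by move=> x y; apply: dr.
- split=> // [x y|v|x y v|x1 x2 x3 x4 v|x1 x2 x3 x4 v].
  + exact: rl.
  + have [a1 a2 a3] := ra v.
    by split=> [y a u w|x a u w|x]; [apply: a1 | apply: a2 | apply: a3].
  + exact: r1.
  + exact: r2.
  + exact: r3.
- by move=> a x; refine (vI _ _ _); apply: aa.
- by move=> x y a z; refine (vI _ _ _); apply: ba.
- by move=> a x y b; apply: ral.
- by move=> a x y b; apply: rar.
Qed.

(* The Hom 3-Lie-Rinehart algebra (I, A, phi, alpha|I, rho|I/\I). *)
Definition ideal_hom3LR : hom3LR A := Hom3LR ideal_hom3LR_axioms.

End IdealAlgebra.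

Section Split.
Variables (L : hom3LR A) (H : submodClosed L).

Definition is_subalgebra (K : submodClosed L) : Prop :=
  forall x y z, x \in K -> y \in K -> z \in K -> br x y z \in K.

Definition is_abelian (K : submodClosed L) : Prop :=
  forall x y z, x \in K -> y \in K -> z \in K -> br x y z = 0.

(* Subalgebras are only asked to be closed under the bracket; requiring them to
   be stable under [alpha] as well would not change [split_with] below, where
   [split_root0] already forces maximality in either sense. *)
Definition maximal_abelian_subalgebra : Prop :=
  [/\ is_subalgebra H, is_abelian H
    & forall K : submodClosed L, is_subalgebra K -> is_abelian K ->
        {subset H <= K} -> {subset K <= H}].

(* (H /\ H)^* *)
Definition wedge_dual : set (subspace H -> subspace H -> F) :=
  [set g | @alternating2 F (subspace H) F^o g].

Definition wedge0 : subspace H -> subspace H -> F := fun _ _ => 0.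

Definition root_space (g : subspace H -> subspace H -> F) : set L :=
  [set x | forall h1 h2 : subspace H,
     br (val h1) (val h2) x = g h1 h2 *: alpha x].

Definition weight_space (l : subspace H -> subspace H -> F) : set A :=
  [set a | forall h1 h2 : subspace H,
     rho (val h1) (val h2) a = l h1 h2 *: phi L a].

Definition root_system : set (subspace H -> subspace H -> F) :=
  [set g | [/\ wedge_dual g, g <> wedge0 & root_space g <> [set 0]]].

Definition weight_system : set (subspace H -> subspace H -> F) :=
  [set l | [/\ wedge_dual l, l <> wedge0 & weight_space l <> [set 0]]].

(* [L] is a split regular Hom 3-Lie-Rinehart algebra with splitting Cartan
   subalgebra [H].  The summand [H] of [L] is the root space of [wedge0], and
   the summand [A_0] of [A] is the weight space of [wedge0]. *)
Record split_with : Prop := SplitWith {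
  split_regular : regular L;
  split_maximal : maximal_abelian_subalgebra;
  split_alpha : alpha @` [set` H] = [set` H];
  split_root0 : root_space wedge0 = [set` H];
  split_roots : direct_sum (wedge0 |` root_system) root_space setT;
  split_weights : direct_sum (wedge0 |` weight_system) weight_space setT }.

End Split.

(* Extension by zero: [H] is a subspace of [L] which is the direct sum of subspaces [Hs j] of
   ideals [G j] of [L]. *)

Section ExtensionByZero.
Variables (L : hom3LR A) (s : nat) (G : 'I_s -> ideal L).
Variable Hs : forall j, submodClosed (ideal_hom3LR (G j)).

Definition image_in (j : 'I_s) : set L :=
  [set val (x : subspace (G j)) | x in [set` Hs j]].

Variable H : submodClosed L.

(* The projection p_j of [H] on [Hs j]; it is only meaningful when [H] is the
   direct sum of the images of the [Hs j]. *)
Definition proj (j : 'I_s) (h : subspace H) : subspace (Hs j) :=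
  xget 0 [set k | exists2 f, decomposition setT image_in (val h) f
                           & f j = val (val k : subspace (G j))].

Definition extend0 (j : 'I_s) (g : subspace (Hs j) -> subspace (Hs j) -> F) :
    subspace H -> subspace H -> F :=
  fun h1 h2 => g (proj j h1) (proj j h2).

End ExtensionByZero.
End Theory.

Arguments wedge_dual {F A L} H.
Arguments wedge0 {F A L} H.
Arguments root_system {F A L} H.
Arguments weight_system {F A L} H.
Arguments extend0 {F A L s G} Hs H j g.

(* Main.v *)
Require Import Defs.
From HB Require Import structures.
From mathcomp Require Import all_boot all_order all_algebra.
From mathcomp Require Import boolp classical_sets functions cardinality fsbigop.
Set Implicit Arguments.
Unset Strict Implicit.
Unset Printing Implicit Defensive.
Import GRing.Theory.
Local Open Scope classical_set_scope.
Local Open Scope ring_scope.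

(** As [alpha] and [phi] are invertible, the root spaces of [L] and the weight
    spaces of [A] are the joint eigenspaces of the operators
    [alpha^-1 (br h1 h2 _)] and [phi^-1 (rho h1 h2 _)], for [h1], [h2] in [H].
    Joint eigenspaces are always independent, and the eigenvalue function of a
    nonzero vector is automatically alternating and bilinear.  Hence the two
    direct sum conditions in the definition of a split algebra only say that
    [L] and [A] are spanned by joint eigenvectors ([twisted_direct_sum]), while
    the maximality of [H] follows from [L_0 = H] ([split_withP]).

    For the ideals, [br (G i) (G j) L] lies in both [G i] and [G j], so it is
    zero when [i] and [j] differ.  Likewise [rho (G i) (G j)] maps [A] into
    [Z_L(A)], which is zero.  So the projection on [G j] is a morphism
    for the bracket ([br_component]), and [rho x y] is the sum of the
    [rho x_j y_j] over the components ([rho_component]).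

    If [L] is split by [H], put [H_j] equal to the trace of [H] on [G j].  The
    components of an element of [L_0 = H] are again in [L_0], so [H] is the sum
    of the [H_j].  The components of a root vector are root vectors for the same
    root, so [G j] is spanned by root vectors ([trace_split]), and
    a root [g] with a nonzero vector in [G j] satisfies
    [g (h1, h2) = g (p_j h1, p_j h2)]: it is extended by zero from [H_j]
    ([restrictK]).  This also gives the description of the root system.
    Weight vectors for [H] are weight vectors for each [H_j].

    Conversely, everything about [L] is obtained by summing over [j].  The
    delicate point is the weight decomposition of [A]: a weight
    vector for one [H_j] need not be one for the others.  Since mixed brackets
    vanish, the compatibility axioms of the representation show that the
    operators [phi^-1 rho] of [G i] commute with those of [G j]
    ([rho_commute]).  Commuting families that are each diagonalizable
    are diagonalizable simultaneously ([commuting_families_eigenvectors]), and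
    a joint eigenvector for all the [H_j] is a weight vector for [H] because
    [rho] has no mixed part ([sums_weight_vectors]). *)

(** * Finite sums and decompositions *)

Section LinearPredicate.
Variables (F : fieldType) (U V : lmodType F) (f : U -> V).
Hypothesis lin_f : linear f.

Let g : {linear U -> V} := HB.pack f (GRing.isLinear.Build F U V _ f lin_f).

Lemma linear_pred0 : f 0 = 0. Proof. exact: (linear0 g). Qed.

Lemma linear_predD : {morph f : x y / x + y}. Proof. exact: (linearD g). Qed.

Lemma linear_predN : {morph f : x / - x}. Proof. exact: (linearN g). Qed.

Lemma linear_predZ a : {morph f : x / a *: x}.
Proof. by move=> x; exact: (linearZ_LR g). Qed.

Lemma linear_pred_sum (I : Type) (r : seq I) (P : pred I) (E : I -> U) :
  f (\sum_(i <- r | P i) E i) = \sum_(i <- r | P i) f (E i).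
Proof. exact: (linear_sum g). Qed.

End LinearPredicate.

Section Sums.
Variables (F : fieldType) (V : lmodType F).
Implicit Types (P Q W : set V).

(** The set of finite sums of elements of [P]; it is the linear span of [P] when
    [P] is stable under scaling, as sets of eigenvectors are. *)
Inductive sums P : set V :=
| sums0 : sums P 0
| sums_add x y : P x -> sums P y -> sums P (x + y).

Lemma sums1 P : P `<=` sums P.
Proof. by move=> x Px; rewrite -[x]addr0; apply: sums_add => //; apply: sums0. Qed.

Lemma sumsD P x y : sums P x -> sums P y -> sums P (x + y).
Proof.
move=> + Py; elim=> [|u v Pu _ IH]; first by rewrite add0r.
by rewrite -addrA; apply: sums_add.
Qed.

Lemma sums_sum P (I : Type) (r : seq I) (f : I -> V) :
  (forall i, sums P (f i)) -> sums P (\sum_(i <- r) f i).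
Proof.
move=> Pf; elim: r => [|i r IH]; first by rewrite big_nil; apply: sums0.
by rewrite big_cons; apply: sumsD.
Qed.

Lemma sums_bind P Q : P `<=` sums Q -> sums P `<=` sums Q.
Proof. by move=> PQ x; elim=> [|u v /PQ Qu _]; [apply: sums0 | apply: sumsD]. Qed.

Lemma sums_sub P Q : P `<=` Q -> sums P `<=` sums Q.
Proof. by move=> PQ; apply: sums_bind => x /PQ; apply: sums1. Qed.

Definition is_subspace W : Prop :=
  W 0 /\ forall a u v, W u -> W v -> W (a *: u + v).

Lemma is_subspaceD W x y : is_subspace W -> W x -> W y -> W (x + y).
Proof. by move=> [_ Wl] Wx Wy; rewrite -[x]scale1r; apply: Wl. Qed.

Lemma is_subspaceZ W a x : is_subspace W -> W x -> W (a *: x).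
Proof. by move=> [W0 Wl] Wx; rewrite -[a *: x]addr0; apply: Wl. Qed.

Lemma is_subspace_sum W (I : eqType) (r : seq I) (f : I -> V) :
  is_subspace W -> (forall i, i \in r -> W (f i)) -> W (\sum_(i <- r) f i).
Proof.
move=> Wl; elim: r => [|i r IH] Wf; first by rewrite big_nil; case: Wl.
rewrite big_cons; apply: is_subspaceD => //.
  by apply: Wf; rewrite mem_head.
by apply: IH => k kr; apply: Wf; rewrite in_cons kr orbT.
Qed.

End Sums.

Section Decompositions.
Variables (F : fieldType) (V : lmodType F).

(** Finite-support sums are easier to manipulate over an explicit sequence that
    contains the support, which may be chosen common to several functions. *)
Lemma fsum_seq (I : choiceType) (D : set I) (f : I -> V) (s : seq I) :
  uniq s -> (forall i, f i != 0 -> i \in s) -> (forall i, ~ D i -> f i = 0) ->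
  \sum_(i \in D) f i = \sum_(i <- s) f i.
Proof.
move=> us fs f0.
rewrite (fsbig_widen D setT) // => [|i [_ Di] /=]; last exact: f0.
rewrite [RHS]fsbig_seq // [RHS](fsbig_widen _ setT) // => i [_ /= /negP si].
by apply/eqP; apply: contraNT si; apply: fs.
Qed.

Lemma decomposition_seq (I : choiceType) (D : set I) (W : I -> set V) x f
    (s : seq I) : uniq s -> (forall i, f i != 0 -> i \in s) ->
  decomposition D W x f -> x = \sum_(i <- s) f i.
Proof. by move=> us fs [_ f0 _ ->]; apply: fsum_seq. Qed.

Lemma decomposition_add (I : choiceType) (D : set I) (W : I -> set V) x y f i :
  (forall i, is_subspace (W i)) -> D i -> W i x -> decomposition D W y f ->
  decomposition D W (x + y) (fun k => (if k == i then x else 0) + f k).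
Proof.
move=> Wl Di Wx dec; have [Wf f0 finf _] := dec.
split.
- move=> k Dk; apply: is_subspaceD => //; last exact: Wf.
  by case: eqP => [->//|_]; case: (Wl k).
- move=> k nDk; rewrite (f0 k) // addr0; case: eqP => // ki.
  by case: nDk; rewrite ki.
- apply: (@sub_finite_set _ _ ([set i] `|` [set k | f k != 0])).
    move=> k /=; have [->|_] := eqVneq k i; first by left.
    by rewrite add0r; right.
  by rewrite finite_setU; split.
- have /finite_seqP[s sE] : finite_set ([set i] `|` [set k | f k != 0]).
    by rewrite finite_setU; split.
  have fs k : f k != 0 -> k \in undup s.
    move=> fk; rewrite mem_undup; suff: [set` s] k by [].
    by rewrite -sE; right.
  have is_ : i \in undup s.
    by rewrite mem_undup; suff: [set` s] i by []; rewrite -sE; left.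
  rewrite (decomposition_seq (undup_uniq s) fs dec).
  rewrite (fsum_seq (undup_uniq s)) => [|k|k nDk].
  + rewrite big_split /=; congr (_ + _).
    rewrite (bigD1_seq i) ?undup_uniq //= eqxx big1 ?addr0 // => k ki.
    by rewrite (negbTE ki).
  + by have [->//|_] := eqVneq k i; rewrite add0r; apply: fs.
  + by rewrite (f0 k) // addr0; case: eqP => // ki; case: nDk; rewrite ki.
Qed.

(** Summands that lie in the same [W i] are collected into a single component,
    which is possible because each [W i] is a subspace. *)
Lemma sums_decomposition (I : choiceType) (D : set I) (W : I -> set V) x :
  (forall i, is_subspace (W i)) ->
  sums [set y | exists2 i, D i & W i y] x -> exists f, decomposition D W x f.
Proof.
move=> Wl; elim=> [|u v [i Di Wu] _ [f dec]].
  exists (fun=> 0); split=> // [i _||].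
  - by case: (Wl i).
  - by rewrite (_ : [set _ | _] = set0) // predeqE => i /=; rewrite eqxx.
  - by rewrite fsbig1.
by eexists; apply: decomposition_add dec; first exact: Wl; eassumption.
Qed.

Lemma decomposition_sums (I : choiceType) (D : set I) (W : I -> set V) x f :
  decomposition D W x f -> sums [set y | exists2 i, D i & W i y] x.
Proof.
move=> dec; have [Wf f0 /finite_seqP[s sE] _] := dec.
have fs i : f i != 0 -> i \in undup s.
  by move=> fi; rewrite mem_undup; suff: [set` s] i by []; rewrite -sE.
rewrite (decomposition_seq (undup_uniq s) fs dec).
apply: sums_sum => i; have [Di|/f0->] := pselect (D i); last exact: sums0.
by apply: sums1; exists i => //; apply: Wf.
Qed.

Lemma decomposition_fin (I : finType) (W : I -> set V) x f :
  decomposition setT W x f <-> (forall i, W i (f i)) /\ x = \sum_i f i.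
Proof.
have sE : \sum_(i \in [set: I]) f i = \sum_i f i.
  apply: fsum_seq => // [|i _|i []//]; first exact: index_enum_uniq.
  exact: mem_index_enum.
split=> [[Wf _ _ ->]|[Wf ->]]; first by rewrite sE; split=> // i; apply: Wf.
split=> //; by [move=> i []|exact: finite_finset|rewrite sE].
Qed.

End Decompositions.

(** * Joint eigenspaces of a family of operators *)

Section JointEigenspaces.
Variables (F : fieldType) (V : lmodType F) (K : Type) (T : K -> V -> V).
Hypothesis lin_T : forall k, linear (T k).

Definition joint_eigenspace (c : K -> F) : set V :=
  [set x | forall k, T k x = c k *: x].

Definition joint_eigenvector : set V :=
  [set x | exists c, joint_eigenspace c x].

Lemma joint_eigenspace_subspace c : is_subspace (joint_eigenspace c).
Proof.
split=> [k|a u v Tu Tv k]; first by rewrite scaler0 linear_pred0.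
by rewrite (lin_T k) Tu Tv scalerDr !scalerA mulrC.
Qed.

(** An invariant subspace contains the components of each of its elements. If
    two indices have different eigenvalues for [T k], then [T k - chi i0 k]
    kills the component of index [i0] and only rescales the others, so induction
    on the number of components applies. The case where [W] is zero is the
    independence of the joint eigenspaces. *)
Lemma eigen_components_in (W : set V) (I : eqType) (chi : I -> K -> F)
    (s : seq I) (f : I -> V) :
  is_subspace W -> (forall k x, W x -> W (T k x)) -> injective chi ->
  uniq s -> (forall i, i \in s -> joint_eigenspace (chi i) (f i)) ->
  W (\sum_(i <- s) f i) -> forall i, i \in s -> W (f i).
Proof.
move=> Wl WT chi_inj; elim: s f => // i0 s IH f /= /andP[i0s us] Ef Ws.
have Wtail i : i \in s -> W (f i).
  move=> si.
  have [k nk] : exists k, chi i k != chi i0 k.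
    apply: contrapT => /forallNP ne; move: i0s.
    suff -> : i0 = i by rewrite si.
    apply: chi_inj; apply: funext => k; apply/esym/eqP.
    by have /negP := ne k; rewrite negbK.
  have : forall j, j \in s -> W ((chi j k - chi i0 k) *: f j).
    apply: (IH (fun j => (chi j k - chi i0 k) *: f j)) => // [j sj|].
      apply: (is_subspaceZ _ (joint_eigenspace_subspace (chi j))).
      by apply: Ef; rewrite in_cons sj orbT.
    (* apply [T k - chi i0 k] to the whole sum *)
    have <- : (- chi i0 k) *: (\sum_(j <- i0 :: s) f j)
              + T k (\sum_(j <- i0 :: s) f j)
              = \sum_(j <- s) (chi j k - chi i0 k) *: f j.
      rewrite (linear_pred_sum (lin_T k)) scaler_sumr -big_split /= big_cons.
      rewrite (Ef i0) ?mem_head // scaleNr addNr add0r.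
      apply: eq_big_seq => j sj; rewrite Ef ?in_cons ?sj ?orbT //.
      by rewrite scalerBl scaleNr addrC.
    by case: Wl => _; apply=> //; apply: WT.
  move=> /(_ i si) /(is_subspaceZ ((chi i k - chi i0 k)^-1) Wl).
  by rewrite scalerA mulVf ?scale1r // subr_eq0.
move=> i; rewrite in_cons => /predU1P[->|]; last exact: Wtail.
have -> : f i0 = (-1) *: (\sum_(i <- s) f i) + \sum_(i <- i0 :: s) f i.
  by rewrite big_cons scaleN1r addrC addrK.
case: (Wl) => _; apply=> //; exact: is_subspace_sum.
Qed.

Lemma eigen_decomposition_unique (I : choiceType) (D : set I)
    (chi : I -> K -> F) x f g : injective chi ->
  decomposition D (joint_eigenspace \o chi) x f ->
  decomposition D (joint_eigenspace \o chi) x g -> f = g.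
Proof.
move=> chi_inj df dg.
have [Wf f0 finf _] := df; have [Wg g0 fing _] := dg.
have /finite_seqP[s sE] : finite_set ([set k | f k != 0] `|` [set k | g k != 0]).
  by rewrite finite_setU.
have fs k : f k != 0 -> k \in undup s.
  by move=> fk; rewrite mem_undup; suff: [set` s] k by []; rewrite -sE; left.
have gs k : g k != 0 -> k \in undup s.
  by move=> fk; rewrite mem_undup; suff: [set` s] k by []; rewrite -sE; right.
apply: funext => i; apply/eqP; rewrite -subr_eq0; apply/eqP.
have [si|si] := boolP (i \in undup s); last first.
  have /eqP-> : f i == 0 by apply: contraNT si; apply: fs.
  have /eqP-> : g i == 0 by apply: contraNT si; apply: gs.
  by rewrite subr0.
apply: (@eigen_components_in [set 0] _ chi (undup s) (fun i => f i - g i)) => //.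
- by split=> // a u v /= -> ->; rewrite scaler0 addr0.
- by move=> k y /= ->; rewrite linear_pred0.
- exact: undup_uniq.
- move=> j _; have [Dj|nDj] := pselect (D j); last first.
    by rewrite f0 // g0 // subr0; case: (joint_eigenspace_subspace (chi j)).
  rewrite addrC -scaleN1r; case: (joint_eigenspace_subspace (chi j)) => _; apply.
    exact: Wg.
  exact: Wf.
- rewrite sumrB /= -(decomposition_seq (undup_uniq s) fs df).
  by rewrite -(decomposition_seq (undup_uniq s) gs dg) subrr.
Qed.

(** Uniqueness of decompositions is free for joint eigenspaces, so that being
    their direct sum reduces to a spanning condition.  The indexing by [chi]
    makes room for eigenvalue functions that are given in curried form. *)
Lemma eigen_direct_sum (I : choiceType) (D : set I) (chi : I -> K -> F) :
  injective chi ->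
  direct_sum D (joint_eigenspace \o chi) setT <->
  forall x, sums [set y | exists2 i, D i & joint_eigenspace (chi i) y] x.
Proof.
move=> chi_inj; split=> [[_ ds] x|sp].
  by have [f [df _]] := ds x Logic.I; apply: decomposition_sums df.
split=> // x _; have [|f df] := sums_decomposition _ (sp x).
  by move=> i; apply: joint_eigenspace_subspace.
by exists f; split=> // g dg; apply: eigen_decomposition_unique df dg.
Qed.

Lemma invariant_sums_eigenvectors (W : set V) :
  is_subspace W -> (forall k x, W x -> W (T k x)) ->
  (forall x, sums joint_eigenvector x) -> W `<=` sums (joint_eigenvector `&` W).
Proof.
move=> Wl WT sp x Wx.
have [||f df] := @sums_decomposition _ _ (K -> F) setT joint_eigenspace x.
- exact: joint_eigenspace_subspace.
- by apply: sums_sub (sp x) => y [c Ey]; exists c.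
have [Wf _ /finite_seqP[s sE] _] := df.
have fs k : f k != 0 -> k \in undup s.
  by move=> fk; rewrite mem_undup; suff: [set` s] k by []; rewrite -sE.
rewrite (decomposition_seq (undup_uniq s) fs df) in Wx *.
have us := undup_uniq s.
have := @eigen_components_in W _ id (undup s) f Wl WT (@inj_id _) us.
move=> /(_ (fun i _ => Wf i Logic.I) Wx) Wfi.
apply: sums_sum => i; have [si|si] := boolP (i \in undup s).
  by apply: sums1; split; [exists i; apply: Wf | apply: Wfi].
have /eqP-> : f i == 0 by apply: contraNT si; apply: fs.
exact: sums0.
Qed.

End JointEigenspaces.


(** Simultaneous diagonalization. Given a joint eigenvector [x] of the families
    in [s], the vectors on which these families act by the same scalars as on
    [x] form a subspace that a further commuting family leaves invariant; hence
    the components of [x] for that family belong to it. *)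
Lemma commuting_families_eigenvectors (F : fieldType) (V : lmodType F)
    (J : eqType) (K : J -> Type) (T : forall j, K j -> V -> V) (s : seq J) :
  (forall j k, linear (T j k)) ->
  (forall i j k l x, i != j -> T i k (T j l x) = T j l (T i k x)) ->
  (forall j x, sums (joint_eigenvector (T j)) x) ->
  uniq s -> forall x,
    sums [set y | forall j, j \in s -> joint_eigenvector (T j) y] x.
Proof.
move=> lin_T comm_T sp; elim: s => [_ x|i s IH /= /andP[si us] x].
  by apply: sums1.
apply: sums_bind (IH us x) => {}x Ex.
(* quantifying over the scalars [c] avoids choosing an eigenvalue function
   for each [j] in [s] *)
pose W : set V := [set z | forall j k c, j \in s ->
  T j k x = c *: x -> T j k z = c *: z].
apply: sums_sub (@invariant_sums_eigenvectors _ _ _ (T i) (lin_T i) W _ _ _ x _).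
- move=> z [Ez Wz] j; rewrite in_cons => /predU1P[->//|sj].
  by have [c Ec] := Ex j sj; exists c => k; apply: Wz.
- split=> [j k c sj _|a u v Wu Wv j k c sj Ek].
    by rewrite linear_pred0 ?scaler0.
  by rewrite lin_T (Wu _ _ _ sj Ek) (Wv _ _ _ sj Ek) scalerDr !scalerA mulrC.
- move=> k z Wz j l c sj El; rewrite comm_T; last first.
    by apply: contraNneq si => <-.
  by rewrite (Wz _ _ _ sj El) linear_predZ.
- exact: sp.
- by [].
Qed.

Lemma scaler_inj (F : fieldType) (V : lmodType F) (v : V) :
  v != 0 -> injective (fun a : F => a *: v).
Proof.
move=> v0 a b /eqP; rewrite -subr_eq0 -scalerBl scaler_eq0 (negbTE v0) orbF.
by rewrite subr_eq0 => /eqP.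
Qed.

Lemma nonzero_vector (F : fieldType) (V : lmodType F) (W : set V) :
  W 0 -> W <> [set 0] -> exists2 x, W x & x != 0.
Proof.
move=> W0 WN0; apply: contrapT => nW; apply: WN0; rewrite predeqE => x.
split=> [Wx|->//]; apply/eqP; apply: contrapT => /negP x0.
by apply: nW; exists x.
Qed.

(** * Eigenspaces twisted by an invertible map *)

Section TwistedEigenspaces.
Variables (F : fieldType) (S V : lmodType F) (B : S -> S -> V -> V).
Variable phi : V -> V.
Hypothesis lin_phi : linear phi.
Hypothesis lin_B : forall s t, linear (B s t).
Hypothesis alt_B : forall v, alternating2 (fun s t => B s t v).

(** With [B := br], [phi := alpha] these are the root spaces of [L], and with
    [B := rho], [phi := phi] the weight spaces of [A]. *)
Definition twisted_eigenspace (g : S -> S -> F) : set V :=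
  [set x | forall s t, B s t x = g s t *: phi x].

Lemma twisted_eigenspace0 g : twisted_eigenspace g 0.
Proof. by move=> s t; rewrite (linear_pred0 (lin_B s t)) linear_pred0 ?scaler0. Qed.

(** [g s t] is the coordinate of [B s t x] on the nonzero vector [phi x], so
    that it inherits the multilinearity of [B]. *)
Lemma twisted_eigen_alternating g x : injective phi -> x != 0 ->
  twisted_eigenspace g x -> @alternating2 F S F^o g.
Proof.
move=> phi_inj x0 Ex; have [l1 l2 a] := alt_B x.
have px0 : phi x != 0.
  by apply: contraNneq x0 => px; apply/eqP/phi_inj; rewrite px linear_pred0.
split=> [t c u v|s c u v|s]; apply: (scaler_inj px0) => /=.
- transitivity ((c * g u t + g v t) *: phi x) => //.
  by rewrite scalerDl -scalerA -!Ex l1.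
- transitivity ((c * g s u + g s v) *: phi x) => //.
  by rewrite scalerDl -scalerA -!Ex l2.
- by rewrite scale0r -Ex a.
Qed.

(** Composing with the inverse of [phi] turns twisted eigenspaces into ordinary
    joint eigenspaces. The conditions imposed on the indices exclude only
    functions whose eigenspace is zero, hence they do not affect the span. *)
Lemma twisted_direct_sum : bijective phi ->
  direct_sum ((fun _ _ => 0 : F) |` [set g : S -> S -> F | [/\
      @alternating2 F S F^o g, g <> (fun _ _ => 0 : F) & twisted_eigenspace g <> [set 0]]])
    twisted_eigenspace setT <->
  forall x, sums [set y | exists g, twisted_eigenspace g y] x.
Proof.
move=> [psi phiK psiK].
have lin_psi : linear psi.
  by move=> a u v; apply: (can_inj phiK); rewrite lin_phi !psiK.
pose T (k : S * S) x := psi (B k.1 k.2 x).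
have lin_T k : linear (T k) by move=> a u v; rewrite /T lin_B lin_psi.
pose chi (g : S -> S -> F) (k : S * S) := g k.1 k.2.
have chi_inj : injective chi.
  move=> g h /funeqP gh; apply: funext => s; apply: funext => t.
  exact: (gh (s, t)).
have WE : twisted_eigenspace = joint_eigenspace T \o chi.
  apply: funext => g; rewrite predeqE => x; split=> [Ex [s t]|Ex s t].
    by rewrite /T /= Ex linear_predZ // phiK.
  have := Ex (s, t); rewrite /T /= => /(congr1 phi).
  by rewrite psiK linear_predZ.
rewrite [X in direct_sum _ X]WE (eigen_direct_sum lin_T _ chi_inj).
have WgE g y : joint_eigenspace T (chi g) y = twisted_eigenspace g y.
  by rewrite WE.
split=> sp x; apply: sums_bind (sp x) => {}x [g].
  by rewrite WgE => _ Ex; apply: sums1; exists g.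
move=> Ex; have [->|x0] := eqVneq x 0; first exact: sums0.
apply: sums1; exists g; last by rewrite WgE.
have [->|g0] := pselect (g = (fun _ _ => 0)); [by left | right; split=> //].
  exact: twisted_eigen_alternating (can_inj phiK) x0 Ex.
by move=> Wg; move: Ex x0; rewrite Wg => ->; rewrite eqxx.
Qed.

End TwistedEigenspaces.

(** * A criterion for being split *)

Section SplitCriterion.
Variables (F : fieldType) (A : comAssocAlg F) (L : hom3LR A).
Variable H : submodClosed L.
Implicit Types (x y z : L) (h : subspace H).

Definition root_vector : set L := [set x | exists g, root_space (H := H) g x].

Definition weight_vector : set A := [set a | exists l, weight_space (H := H) l a].

Lemma alphaP : linear (@alpha F A L).
Proof. exact: alpha_linear (LR_hom3Lie (LR_axioms L)). Qed.

Lemma phiP : linear (phi L).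
Proof. by have [] := LR_phi (LR_axioms L). Qed.

Lemma br_alternatingP : alternating3 (@br F A L).
Proof. exact: br_alternating (LR_hom3Lie (LR_axioms L)). Qed.

Lemma br_linear3 x y : linear (br x y).
Proof. by have [_ _ l3 _] := br_alternatingP; apply: l3. Qed.

Lemma rho_linear x y : linear (rho x y : A -> A).
Proof. exact: rep_rho_linear (LR_rep (LR_axioms L)) x y. Qed.

Lemma rho_alternating a : alternating2 (fun x y => rho x y a).
Proof. exact: rep_rho_alternating (LR_rep (LR_axioms L)) a. Qed.

Lemma br_restrict_alternating x :
  alternating2 (fun h1 h2 => br (val h1) (val h2) x).
Proof.
have [l1 l2 _ a] := br_alternatingP.
by split=> [h2 c u v|h1 c u v|h]; [apply: l1|apply: l2|case: (a (val h) x)].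
Qed.

Lemma rho_restrict_alternating a :
  alternating2 (fun h1 h2 => rho (val h1) (val h2) a).
Proof.
have [l1 l2 a0] := rho_alternating a.
by split=> [h2 c u v|h1 c u v|h]; [apply: l1|apply: l2|apply: a0].
Qed.

(** Maximality needs no separate statement: an abelian subalgebra that contains
    [H] is killed by the brackets with [H], hence lies in [L_0], which is [H]. *)
Lemma split_withP : regular L ->
  split_with H <->
  [/\ is_abelian H, alpha @` [set` H] = [set` H],
      forall x, (forall h1 h2, br (val h1) (val h2) x = 0) -> x \in H,
      forall x, sums root_vector x
    & forall a, sums weight_vector a].
Proof.
move=> regL; have [bij_alpha bij_phi] := regL.
have dsL := twisted_direct_sum alphaP (fun h1 h2 => br_linear3 _ _)
  br_restrict_alternating bij_alpha.
have dsA := twisted_direct_sum phiP (fun h1 h2 => rho_linear _ _)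
  rho_restrict_alternating bij_phi.
have root0E x : root_space (wedge0 H) x <->
    forall h1 h2, br (val h1) (val h2) x = 0.
  by split=> Ex h1 h2; have := Ex h1 h2; rewrite scale0r.
split=> [[_ [_ abH _] aH r0 rL rA]|[abH aH r0 rL rA]].
  split=> // [x /root0E||]; [by rewrite r0|exact/dsL|exact/dsA].
have H0 x : x \in H -> root_space (wedge0 H) x.
  by move=> xH; apply/root0E => h1 h2; apply: abH => //; apply: valP.
split=> //.
- split=> // [x y z xH yH zH|K sK abK HK x xK].
    by rewrite abH ?rpred0.
  by apply: r0 => h1 h2; apply: abK => //; apply: HK; apply: valP.
- by rewrite predeqE => x; split=> [/root0E/r0//|]; apply: H0.
- exact/dsL.
- exact/dsA.
Qed.

End SplitCriterion.

(** * Decompositions into ideals *)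

Section IdealTrace.
Variables (F : fieldType) (A : comAssocAlg F) (L : hom3LR A).
Variables (I : ideal L) (H : submodClosed L).

Definition trace_pred : {pred subspace I} := fun x => val x \in H.

Lemma trace_pred_submod : submod_closed trace_pred.
Proof.
split=> [|a x y xH yH]; first exact: rpred0.
by rewrite unfold_in; apply: rpredD; first exact: rpredZ.
Qed.

HB.instance Definition _ :=
  GRing.isSubmodClosed.Build F (subspace I) trace_pred trace_pred_submod.

Definition trace : submodClosed (ideal_hom3LR I) := trace_pred.

End IdealTrace.

Section IdealDecomposition.
Variables (F : fieldType) (A : comAssocAlg F) (L : hom3LR A).
Variables (s : nat) (G : 'I_s -> ideal L).
Hypothesis decL : direct_sum setT (fun j => [set` G j]) [set: L].
Implicit Types (x y z : L) (i j : 'I_s).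

Lemma br_swap12 x y z : br x y z = - br y x z.
Proof.
have [l1 l2 _ a] := br_alternatingP L.
have b0 u : br u u z = 0 by case: (a u z).
have := b0 (x + y).
rewrite (linear_predD (l1 _ _)) !(linear_predD (l2 _ _)) !b0 add0r addr0.
by move=> /eqP; rewrite addr_eq0 => /eqP.
Qed.

Lemma br_swap13 x y z : br x y z = - br z y x.
Proof.
have [l1 _ l3 a] := br_alternatingP L.
have b0 u : br u y u = 0 by case: (a u y).
have := b0 (x + z).
rewrite (linear_predD (l1 _ _)) !(linear_predD (l3 _ _)) !b0 add0r addr0.
by move=> /eqP; rewrite addr_eq0 => /eqP.
Qed.

Lemma submod_rpredN (S : submodClosed L) x : x \in S -> - x \in S.
Proof. by rewrite -scaleN1r; apply: rpredZ. Qed.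

Lemma ideal_br2 (I : ideal L) x y z : y \in I -> br x y z \in I.
Proof. by move=> yI; rewrite br_swap12; apply/submod_rpredN/ideal_br. Qed.

Lemma ideal_br3 (I : ideal L) x y z : z \in I -> br x y z \in I.
Proof. by move=> zI; rewrite br_swap13; apply/submod_rpredN/ideal_br. Qed.

Definition component j x : L :=
  xget (fun=> 0) [set f | decomposition setT (fun j => [set` G j]) x f] j.

Lemma componentP x :
  decomposition setT (fun j => [set` G j]) x (fun j => component j x).
Proof.
have [_ ds] := decL; have [f [df _]] := ds x Logic.I.
exact: (xgetPex (fun=> 0) (ex_intro
  [set f | decomposition setT (fun j => [set` G j]) x f] f df)).
Qed.

Lemma component_in j x : component j x \in G j.
Proof. by have /decomposition_fin[cG _] := componentP x; apply: cG. Qed.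

Lemma sum_component x : \sum_j component j x = x.
Proof. by have /decomposition_fin[_ <-] := componentP x. Qed.

Lemma component_unique x (f : 'I_s -> L) :
  (forall j, f j \in G j) -> x = \sum_j f j -> forall j, component j x = f j.
Proof.
move=> fG xE; have [_ ds] := decL; have [g [_ dg]] := ds x Logic.I.
have <- : g = f by apply: dg; apply/decomposition_fin.
by move=> j; rewrite (dg _ (componentP x)).
Qed.

Lemma component_id i j x : x \in G j -> component i x = if i == j then x else 0.
Proof.
move=> xG.
apply: (component_unique (f := fun i => if i == j then x else 0)) => [k|].
  by case: eqP => [->//|_]; apply: rpred0.
by rewrite -big_mkcond big_pred1_eq.
Qed.

Lemma component_same j x : x \in G j -> component j x = x.
Proof. by move=> /(component_id j) ->; rewrite eqxx. Qed.

Lemma component_mem j x : component j x = x -> x \in G j.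
Proof. by move=> <-; apply: component_in. Qed.

Lemma ideals_disjoint i j x : i != j -> x \in G i -> x \in G j -> x = 0.
Proof.
by move=> ij xi xj; rewrite -(component_same xi) (component_id i xj) (negbTE ij).
Qed.

Lemma component_linear j : linear (component j).
Proof.
move=> a x y; rewrite (component_unique (f := fun j =>
  a *: component j x + component j y)) // => [k|].
  by apply: rpredD; [apply: rpredZ|]; apply: component_in.
by rewrite big_split /= -scaler_sumr !sum_component.
Qed.

Lemma component_alpha j x : component j (alpha x) = alpha (component j x).
Proof.
apply: (component_unique (f := fun j => alpha (component j x))) => [k|].
  by apply: ideal_alpha; apply: component_in.
by rewrite -(linear_pred_sum (@alphaP _ _ L)) sum_component.
Qed.

Lemma br_mixed12 i j x y z : i != j -> x \in G i -> y \in G j -> br x y z = 0.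
Proof.
move=> ij xi yj; apply: (ideals_disjoint ij); first exact: ideal_br.
exact: ideal_br2.
Qed.

(** Only the brackets of three elements of the same ideal survive in the
    expansion of [br x y z] along the decomposition. *)
Lemma br_component j x y z :
  component j (br x y z) = br (component j x) (component j y) (component j z).
Proof.
have [l1 l2 l3 _] := br_alternatingP L.
have brE u v w k : u \in G k -> br u v w = br u (component k v) (component k w).
  move=> uk; rewrite -{1}(sum_component v) (linear_pred_sum (l2 _ _)).
  rewrite (bigD1 k) //= big1 ?addr0 => [|i ik]; last first.
    by rewrite (br_mixed12 _ _ uk (component_in i v)) // eq_sym.
  rewrite -{1}(sum_component w) (linear_pred_sum (l3 _ _)).
  rewrite (bigD1 k) //= big1 ?addr0 // => i ik.
  by rewrite br_swap13 (br_mixed12 _ ik) ?oppr0 // component_in.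
apply: (component_unique (f := fun j =>
  br (component j x) (component j y) (component j z))) => [k|].
  by apply: ideal_br; apply: component_in.
rewrite -{1}(sum_component x) (linear_pred_sum (l1 _ _)).
by apply: eq_bigr => k _; apply: brE; apply: component_in.
Qed.

Lemma br_component_in j x y z :
  z \in G j -> br x y z = br (component j x) (component j y) z.
Proof.
move=> zj; rewrite -[LHS](component_same (j := j)) ?br_component.
  by rewrite (component_same zj).
exact: ideal_br3.
Qed.

Section Annihilator.
Hypothesis ZL0 : annihilator L = [set 0].

(** For all [z], the vector [act (rho x y a) z] lies in [G i] and, by the
    skew-symmetry of [rho], also in [G j]; so [rho x y a] annihilates [L]. *)
Lemma rho_mixed i j x y a : i != j -> x \in G i -> y \in G j -> rho x y a = 0.
Proof.
move=> ij xi yj.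
suff : annihilator L (rho x y a) by rewrite ZL0.
move=> z; apply: (ideals_disjoint ij); first exact: ideal_rho.
have -> : rho x y a = - rho y x a.
  have [l1 l2 a0] := rho_alternating L a.
  have := a0 (x + y).
  rewrite (linear_predD (l1 _)) !(linear_predD (l2 _)) !a0 add0r addr0.
  by move=> /eqP; rewrite addr_eq0 => /eqP.
have [_ m2 _] := LR_module (LR_axioms L).
by rewrite (linear_predN (m2 z)); apply/submod_rpredN/ideal_rho.
Qed.

Lemma rho_component x y a :
  rho x y a = \sum_j rho (component j x) (component j y) a.
Proof.
have [l1 l2 _] := rho_alternating L a.
rewrite -{1}(sum_component x) (linear_pred_sum (l1 _)); apply: eq_bigr => j _.
rewrite -{1}(sum_component y) (linear_pred_sum (l2 _)) (bigD1 j) //=.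
rewrite big1 ?addr0 // => i ij.
by rewrite (rho_mixed _ _ (component_in j x) (component_in i y)) // eq_sym.
Qed.

End Annihilator.

(** The commutation axiom of a representation involves the brackets of [x1],
    [x2] with [x3] or [x4], which vanish here; the twisting axiom [rho (alpha x)
    (alpha y) phi = phi rho x y] then removes [alpha]. *)
Lemma rho_commute (psi : A -> A) i j x1 x2 x3 x4 a : i != j ->
  cancel (phi L) psi -> cancel psi (phi L) ->
  x1 \in G i -> x2 \in G i -> x3 \in G j -> x4 \in G j ->
  psi (rho x1 x2 (psi (rho x3 x4 a))) = psi (rho x3 x4 (psi (rho x1 x2 a))).
Proof.
move=> ij phiK psiK x1i x2i x3j x4j; congr psi; apply: (can_inj phiK).
have [_ _ _ tw _ cm] := LR_rep (LR_axioms L).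
rewrite -!tw !psiK cm.
have b0 z : z \in G j -> br x1 x2 z = 0.
  by move=> zj; rewrite br_swap13 (br_mixed12 _ _ zj x2i) ?oppr0 // eq_sym.
rewrite (b0 _ x3j) (b0 _ x4j).
have [l1 l2 _] := rho_alternating L (phi L a).
by rewrite (linear_pred0 (l1 _)) (linear_pred0 (l2 _)) !addr0.
Qed.

(** If [x] is in [G j], the components of [alpha^-1 x] outside [G j] are mapped
    to zero by [alpha], hence vanish. *)
Lemma ideal_regular j : regular L -> regular (ideal_hom3LR (G j)).
Proof.
move=> [[psi alphaK psiK] bij_phi]; split=> //.
have psiG x : x \in G j -> psi x \in G j.
  move=> xj; apply: component_mem; apply: (can_inj alphaK).
  by rewrite -component_alpha psiK component_same.
exists (fun x : subspace (G j) => SubspaceElt (psiG _ (valP x))) => x.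
  by apply: val_inj; rewrite /= alphaK.
by apply: val_inj; rewrite /= psiK.
Qed.

End IdealDecomposition.

Lemma sums_map (F : fieldType) (U V : lmodType F) (P : set U) (Q : set V)
    (f : U -> V) x : linear f ->
  (forall y, P y -> Q (f y)) -> sums P x -> sums Q (f x).
Proof.
move=> lin_f PQ; elim=> [|u v Pu _ Qv]; first by rewrite linear_pred0 //; left.
by rewrite linear_predD //; right=> //; apply: PQ.
Qed.

(** * Roots of an algebra and of its ideals *)

Section CartanDecomposition.
Variables (F : fieldType) (A : comAssocAlg F) (L : hom3LR A).
Variables (s : nat) (G : 'I_s -> ideal L).
Hypothesis decL : direct_sum setT (fun j => [set` G j]) [set: L].
Hypothesis regL : regular L.
Variable Hs : forall j, submodClosed (ideal_hom3LR (G j)).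
Variable H : submodClosed L.
Implicit Types (x y z : L) (h : subspace H).

Lemma alpha_inj : injective (@alpha F A L).
Proof. by case: regL => /bij_inj. Qed.

Definition incl_ideal j (k : subspace (Hs j)) : L := val (val k : subspace (G j)).

Lemma incl_ideal_in j (k : subspace (Hs j)) : incl_ideal k \in G j.
Proof. exact: valP. Qed.

Lemma image_inP j x :
  image_in Hs j x <-> exists k : subspace (Hs j), incl_ideal k = x.
Proof.
split=> [[y yH <-]|[k <-]]; first by exists (SubspaceElt yH).
by exists (val k) => //; apply: (valP k).
Qed.

(** The decomposition of an element of [H] along the [Hs j] is also its
    decomposition along the [G j], so it consists of its components. *)
Lemma cartan_direct_sum : direct_sum setT (image_in Hs) [set` H] <->
  forall x, x \in H <-> forall j, image_in Hs j (component G j x).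
Proof.
split=> [[sub ds] x|HE].
  split=> [xH j|xs].
    have [f [/decomposition_fin[fH xE] _]] := ds x xH.
    rewrite (component_unique decL (f := f)) // => k.
    by have /image_inP[e <-] := fH k; apply: incl_ideal_in.
  rewrite -(sum_component decL x); apply: rpred_sum => j _.
  by apply: (sub j) => //; apply: xs.
split=> [j _ x /image_inP[k <-]|x /= xH].
  apply/HE => i; rewrite (component_id decL _ (incl_ideal_in k)).
  case: eqP => [->|_]; apply/image_inP; first by exists k.
  by exists 0.
exists (fun j => component G j x); split=> [|f /decomposition_fin[fH xE]].
  apply/decomposition_fin; split; last by rewrite sum_component.
  by apply/HE.
apply: funext => j; apply: component_unique => // k.
by have /image_inP[e <-] := fH k; apply: incl_ideal_in.
Qed.

Lemma ideal_root_spaceP j (g : subspace (Hs j) -> subspace (Hs j) -> F)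
    (y : subspace (G j)) :
  root_space g y <-> forall k1 k2,
    br (incl_ideal k1) (incl_ideal k2) (val y) = g k1 k2 *: alpha (val y).
Proof.
split=> Ey k1 k2; first exact: (congr1 val (Ey k1 k2)).
by apply: val_inj; apply: Ey.
Qed.

Lemma root_component j g x :
  root_space (H := H) g x -> root_space g (component G j x).
Proof.
move=> Ex h1 h2.
rewrite (br_component_in decL _ _ (component_in decL j x)).
rewrite -(br_component decL) Ex.
by rewrite (linear_predZ (component_linear decL j)) component_alpha.
Qed.

Hypothesis decH : direct_sum setT (image_in Hs) [set` H].

Lemma projE j h : incl_ideal (proj Hs j h) = component G j (val h).
Proof.
have HE := (cartan_direct_sum.1 decH (val h)).1 (valP h).
have dec : decomposition setT (image_in Hs) (val h)
    (fun j => component G j (val h)).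
  by apply/decomposition_fin; split; [exact: HE | rewrite sum_component].
have /image_inP[k kE] := HE j.
rewrite /proj; set P := [set _ | _].
have [f /decomposition_fin[fH hE] fj] : P (xget 0 P).
  by apply: xgetPex; exists k; exists (fun j => component G j (val h)).
rewrite (component_unique decL (f := f)) // => i.
by have /image_inP[e <-] := fH i; apply: incl_ideal_in.
Qed.

Lemma incl_ideal_cartan j (k : subspace (Hs j)) : incl_ideal k \in H.
Proof. by case: decH => sub _; apply: (sub j) => //; apply/image_inP; exists k. Qed.

Definition incl_cartan j (k : subspace (Hs j)) : subspace H :=
  SubspaceElt (incl_ideal_cartan k).

Lemma incl_ideal_inj j : injective (@incl_ideal j).
Proof. by move=> k1 k2 /val_inj/val_inj. Qed.

Lemma incl_cartanK j : cancel (@incl_cartan j) (proj Hs j).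
Proof.
move=> k; apply: incl_ideal_inj; rewrite projE.
exact: (component_same decL (incl_ideal_in k)).
Qed.

Lemma br_proj j h1 h2 x : x \in G j -> br (val h1) (val h2) x =
  br (incl_ideal (proj Hs j h1)) (incl_ideal (proj Hs j h2)) x.
Proof. by move=> xj; rewrite (br_component_in decL _ _ xj) !projE. Qed.

Definition restrict j (g : subspace H -> subspace H -> F) :
    subspace (Hs j) -> subspace (Hs j) -> F :=
  fun k1 k2 => g (incl_cartan k1) (incl_cartan k2).

Lemma root_space_restrict j g (y : subspace (G j)) :
  root_space g (val y) -> root_space (@restrict j g) y.
Proof.
move=> Ey; apply/ideal_root_spaceP => k1 k2.
exact: (Ey (incl_cartan k1) (incl_cartan k2)).
Qed.

Lemma root_space_extend0 j (g : subspace (Hs j) -> subspace (Hs j) -> F)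
    (y : subspace (G j)) :
  root_space g y -> root_space (extend0 Hs H j g) (val y).
Proof.
by move=> /ideal_root_spaceP Ey h1 h2; rewrite (br_proj _ _ (valP y)) Ey.
Qed.

(** A nonzero root vector in a single ideal [G j] only sees the projections on
    [Hs j], so its root is determined there and extended by zero. *)
Lemma restrictK j g x : x \in G j -> x != 0 -> root_space g x ->
  extend0 Hs H j (restrict g) = g.
Proof.
move=> xj x0 Ex; apply: funext => h1; apply: funext => h2.
have ax0 : alpha x != 0.
  apply: contraNneq x0 => ax; apply/eqP/alpha_inj.
  by rewrite ax (linear_pred0 (@alphaP _ _ L)).
apply: (scaler_inj ax0); rewrite /= -Ex (br_proj _ _ xj).
by rewrite (Ex (incl_cartan _) (incl_cartan _)).
Qed.

Lemma extend0K j (g : subspace (Hs j) -> subspace (Hs j) -> F) :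
  restrict (extend0 Hs H j g) = g.
Proof.
apply: funext => k1; apply: funext => k2.
by rewrite /restrict /extend0 !incl_cartanK.
Qed.

End CartanDecomposition.

Lemma root_space_alternating (F : fieldType) (A : comAssocAlg F) (L : hom3LR A)
    (H : submodClosed L) (g : subspace H -> subspace H -> F) (x : L) :
  regular L -> x != 0 -> root_space g x -> wedge_dual H g.
Proof.
move=> [/bij_inj alpha_inj _] x0 Ex.
exact: (twisted_eigen_alternating (@alphaP _ _ L)
  (@br_restrict_alternating _ _ L H) alpha_inj x0 Ex).
Qed.

Lemma root_space_zero (F : fieldType) (A : comAssocAlg F) (L : hom3LR A)
    (H : submodClosed L) (g : subspace H -> subspace H -> F) : root_space g 0.
Proof.
exact: (twisted_eigenspace0 (@alphaP _ _ L)
  (fun h1 h2 => @br_linear3 _ _ L (val h1) (val h2)) g).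
Qed.

(** * Splitting of an algebra and of its ideals *)

Section SplitDecomposition.
Variables (F : fieldType) (A : comAssocAlg F) (L : hom3LR A).
Variables (s : nat) (G : 'I_s -> ideal L).
Hypothesis decL : direct_sum setT (fun j => [set` G j]) [set: L].
Hypothesis regL : regular L.
Variable H : submodClosed L.

(** A nonzero root vector has a nonzero component in some [G j], which is a root
    vector for the same root; this root is then extended by zero from [Hs j]. *)
Lemma root_system_bigcup (Hs : forall j, submodClosed (ideal_hom3LR (G j))) :
  direct_sum setT (image_in Hs) [set` H] ->
  root_system H = \bigcup_j (extend0 Hs H j @` root_system (Hs j)).
Proof.
move=> decH; rewrite predeqE => g; split.
  move=> [alt_g g0 /(nonzero_vector (root_space_zero g))[x Ex x0]].
  have [j xj0] : exists j, component G j x != 0.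
    apply: contrapT => /forallNP xj0; case/eqP: x0.
    rewrite -(sum_component decL x) big1 // => j _.
    by apply/eqP; have /negP := xj0 j; rewrite negbK.
  have xj := component_in decL j x.
  pose y : subspace (G j) := SubspaceElt xj.
  have Ey : root_space g (val y) := root_component decL j Ex.
  have gE := restrictK decL regL decH xj xj0 Ey.
  exists j => //; exists (restrict decH g) => //.
  have Eyr := root_space_restrict decH Ey.
  have y0 : y != 0 by apply: contraNneq xj0 => /(congr1 val) /= ->.
  split.
  - exact: root_space_alternating (ideal_regular decL j regL) y0 Eyr.
  - by move=> r0; apply: g0; rewrite -gE r0.
  - by move=> W0; move: Eyr y0; rewrite W0 => ->; rewrite eqxx.
move=> [j _ [d [alt_d d0 /(nonzero_vector (root_space_zero d))[y Ey y0]] <-]].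
have Ex := root_space_extend0 decL decH Ey.
have x0 : val y != 0 by apply: contraNneq y0 => yE; apply/eqP/val_inj.
split.
- exact: root_space_alternating regL x0 Ex.
- by move=> e0; apply: d0; rewrite -(extend0K decL decH d) e0.
- by move=> W0; move: Ex x0; rewrite W0 => ->; rewrite eqxx.
Qed.

Lemma image_in_trace j x :
  image_in (fun j => trace (G j) H) j x <-> x \in G j /\ x \in H.
Proof.
split=> [[y yH <-]|[xj xH]]; first by split; [apply: valP | apply: yH].
by exists (SubspaceElt xj).
Qed.

Definition ideal_component j (x : L) : subspace (G j) :=
  SubspaceElt (component_in decL j x).

Lemma ideal_component_linear j : linear (ideal_component j).
Proof. by move=> a u v; apply: val_inj; apply: component_linear. Qed.

Lemma ideal_componentK j : cancel val (ideal_component j).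
Proof. by move=> x; apply: val_inj; apply: (component_same decL (valP x)). Qed.

(** An element [x] of [L] belongs to [H = L_0] when [br h1 h2 x = 0] for all
    [h1], [h2] in [H], a condition that passes to the components of [x]. *)
Lemma trace_direct_sum : split_with H ->
  direct_sum setT (image_in (fun j => trace (G j) H)) [set` H].
Proof.
move=> /(split_withP H regL)[abH _ r0 _ _]; apply/(cartan_direct_sum decL) => x.
split=> [xH j|xs].
  apply/image_in_trace; split; first exact: component_in.
  apply: r0 => h1 h2.
  rewrite (br_component_in decL _ _ (component_in decL j x)).
  rewrite -(br_component decL) abH; try exact: valP; last by [].
  exact: (linear_pred0 (component_linear decL j)).
rewrite -(sum_component decL x); apply: rpred_sum => j _.
by have /image_in_trace[] := xs j.
Qed.

(** Root vectors of [G j] are the components of root vectors of [L]; weight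
    vectors for [H] are weight vectors for the trace, by restriction. *)
Lemma trace_split j : split_with H -> split_with (trace (G j) H).
Proof.
move=> splitH; have decH := trace_direct_sum splitH.
have [abH aH r0 rL rA] := (split_withP H regL).1 splitH.
apply/(split_withP _ (ideal_regular decL j regL)); split.
- by move=> x y z xH yH zH; apply: val_inj; apply: abH.
- rewrite predeqE => x; split=> [[y yH <-]|xH].
    have : [set` H] (alpha (val y)) by rewrite -aH; exists (val y).
    by [].
  have : [set` H] (val x) by exact: xH.
  rewrite -{1}aH => -[y yH yx].
  have yj : y \in G j.
    apply: (component_mem decL); apply: (alpha_inj regL).
    by rewrite -(component_alpha decL) yx (component_same decL (valP x)).
  by exists (SubspaceElt yj) => //; apply: val_inj.
- move=> x Ex; apply: (r0 (val x)) => h1 h2.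
  rewrite (br_proj decL decH _ _ (valP x)).
  exact: (congr1 val (Ex _ _)).
- move=> x; rewrite -(ideal_componentK x).
  apply: sums_map (rL (val x)); first exact: ideal_component_linear.
  move=> y [g Ey]; exists (restrict decH g); apply: root_space_restrict.
  exact: (root_component decL j Ey).
- move=> a; apply: sums_sub (rA a) => b [l El].
  exists (restrict decH l) => k1 k2.
  exact: (El (incl_cartan decH k1) (incl_cartan decH k2)).
Qed.

Hypothesis ZL0 : annihilator L = [set 0].
Variable Hs : forall j, submodClosed (ideal_hom3LR (G j)).

(** The families [phi^-1 rho] attached to the [Hs j] commute pairwise and each
    of them is diagonalizable on [A]. On a joint eigenvector [b], every [rho h1
    h2] acts as a sum over [j] of multiples of [phi b]. *)
Lemma sums_weight_vectors (decH : direct_sum setT (image_in Hs) [set` H]) :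
  (forall j a, sums (weight_vector (Hs j)) a) ->
  forall a, sums (weight_vector H) a.
Proof.
move=> rA a; have [_ [psi phiK psiK]] := regL.
have lin_psi : linear psi.
  by move=> c u v; apply: (can_inj phiK); rewrite phiP !psiK.
pose K j : Type := (subspace (Hs j) * subspace (Hs j))%type.
pose T j (k : K j) a : A := psi (rho (incl_ideal k.1) (incl_ideal k.2) a).
have := @commuting_families_eigenvectors _ _ _ K T (enum 'I_s).
move=> /(_ _ _ _ (enum_uniq _) a) spA.
apply: sums_sub (spA _ _ _) => [b Eb|j k|i j k l x ij|j b].
- have [c cP] : {c : subspace H * subspace H -> F &
      forall h, rho (val h.1) (val h.2) b = c h *: phi L b}.
    apply: (@choice _ _ (fun h c =>
      rho (val h.1) (val h.2) b = c *: phi L b)) => h.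
    rewrite (rho_component decL ZL0).
    apply: (@is_subspace_sum _ _ [set v | exists c, v = c *: phi L b]).
      split=> [|c u v [d ->] [e ->]]; first by exists 0; rewrite scale0r.
      by exists (c * d + e); rewrite scalerDl scalerA.
    move=> j _; have [d Ed] := Eb j (mem_enum _ j).
    exists (d (proj Hs j h.1, proj Hs j h.2)).
    have := Ed (proj Hs j h.1, proj Hs j h.2).
    rewrite /T /= !(projE decL decH) => /(congr1 (phi L)).
    by rewrite psiK (linear_predZ (@phiP _ _ L)).
  by exists (fun h1 h2 => c (h1, h2)) => h1 h2; apply: (cP (h1, h2)).
- by move=> c u v; rewrite /T rho_linear lin_psi.
- by apply: (rho_commute decL _ ij phiK psiK); apply: incl_ideal_in.
- apply: sums_sub (rA j b) => d [l El]; exists (fun k => l k.1 k.2) => -[k1 k2].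
  rewrite /T /= (_ : rho _ _ d = l k1 k2 *: phi L d); last exact: El.
  by rewrite linear_predZ // phiK.
Qed.

(** All the conditions on [L] hold componentwise, except the one on weights. *)
Lemma split_direct_sum : direct_sum setT (image_in Hs) [set` H] ->
  (forall j, split_with (Hs j)) -> split_with H.
Proof.
move=> decH splitHs; have HE := (cartan_direct_sum decL Hs H).1 decH.
have spl j := (split_withP _ (ideal_regular decL j regL)).1 (splitHs j).
apply/(split_withP H regL); split.
- move=> x y z xH yH zH; rewrite -(sum_component decL (br x y z)) big1 // => j _.
  rewrite (br_component decL).
  have /image_inP[k1 <-] := (HE x).1 xH j.
  have /image_inP[k2 <-] := (HE y).1 yH j.
  have /image_inP[k3 <-] := (HE z).1 zH j.
  have [abj _ _ _ _] := spl j.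
  exact: (congr1 val (abj _ _ _ (valP k1) (valP k2) (valP k3))).
- rewrite predeqE => x; split=> [[y /HE yH <-]|/HE xH].
    apply/HE => j; rewrite (component_alpha decL).
    have [u uH <-] := yH j; have [_ aj _ _ _] := spl j.
    exists (alpha u) => //.
    by have : (alpha @` [set` Hs j]) (alpha u) by [exists u]; rewrite aj.
  have [[psi alphaK psiK] _] := regL.
  exists (psi x) => //; apply/HE => j.
  have [u uH ux] := xH j; have [_ aj _ _ _] := spl j.
  move: uH; rewrite -{1}aj => -[v vH vu]; exists v => //.
  apply: (can_inj alphaK).
  by rewrite -(component_alpha decL) psiK -ux -vu.
- move=> x Ex; apply/HE => j; exists (ideal_component j x) => //.
  have [_ _ r0 _ _] := spl j; apply: r0 => k1 k2; apply: val_inj.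
  have := congr1 (component G j) (Ex (incl_cartan decH k1) (incl_cartan decH k2)).
  rewrite (br_component decL) (linear_pred0 (component_linear decL j)) /=.
  by rewrite !(component_same decL (incl_ideal_in _)).
- move=> x; rewrite -(sum_component decL x); apply: sums_sum => j.
  have [_ _ _ rLj _] := spl j.
  apply: (sums_map (f := val) _ _ (rLj (ideal_component j x))).
    by move=> c u v.
  move=> y [g Ey]; exists (extend0 Hs H j g).
  exact: root_space_extend0.
- by apply: sums_weight_vectors => // j; have [] := spl j.
Qed.

End SplitDecomposition.

Theorem theorem4p16 (F : fieldType) (charF0 : [pchar F] =i pred0)
    (A : comAssocAlg F) (L : hom3LR A) (regL : regular L)
    (s : nat) (G : 'I_s -> ideal L)
    (decL : direct_sum setT (fun j => [set` G j]) [set: L])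
    (ZL0 : annihilator L = [set 0])
    (H : submodClosed L) :
  split_with H <->
  exists Hs : forall j, submodClosed (ideal_hom3LR (G j)),
    [/\ forall j, split_with (Hs j),
        direct_sum setT (image_in Hs) [set` H]
      & root_system H = \bigcup_j (extend0 Hs H j @` root_system (Hs j))].
Proof.
split=> [splitH|[Hs [splitHs decH _]]]; last exact: split_direct_sum splitHs.
have decH := trace_direct_sum decL regL splitH.
exists (fun j => trace (G j) H); split=> // [j|].
  exact: trace_split splitH.
exact: root_system_bigcup.
Qed.
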